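(* Let $m\ge1$ and $0<q<1$, and let $A_q=\{\mathcal D_q,\mathcal Z\}$, $B_q=\{\mathcal D_q^\dagger,\mathcal Z^\dagger\}$ on $\mathscr P_m$. For all multi-indices $\alpha,\beta\in\mathbb N_0^m$ and all $S\subseteq\{1,\dots,m\}$, $$A_q(z^\alpha w^\beta e_S)=\Bigl(\sum_{i=1}^m[\alpha_i+\mathbf 1_{i\in S}]_q\Bigr)z^\alpha w^\beta e_S,\qquad B_q(z^\alpha w^\beta e_S)=\Bigl(\sum_{i=1}^m[\beta_i+1-\mathbf 1_{i\in S}]_q\Bigr)z^\alpha w^\beta e_S.$$ Moreover $[A_q,\mathcal D_q]=[A_q,\mathcal Z]=0$ and $[B_q,\mathcal D_q^\dagger]=[B_q,\mathcal Z^\dagger]=0$ (commutators). The kernel of $A_q$ is the linear span of the monomial spinors $z^\alpha w^\beta e_S$ with $\alpha=0$ and $S=\varnothing$; the kernel of $B_q$ is the linear span of those with $\beta=0$ and $S=\{1,\dots,m\}$.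
   Context: $\{X,Y\}=XY+YX$, $[r]_q=\frac{1-q^r}{1-q}$. $\mathscr P_m=\mathbb C[z_1,\dots,z_m,w_1,\dots,w_m]\otimes\bigwedge\mathbb C^m$, with standard orthonormal basis $e_S$ ($S\subseteq\{1,\dots,m\}$) of $\bigwedge\mathbb C^m$. $D_{q,x}f=\frac{f(\dots,qx,\dots)-f(\dots,x,\dots)}{(q-1)x}$ is the Jackson derivative in the coordinate $x$. $\varepsilon_i$ is exterior multiplication by the $i$-th basis vector and $\iota_i=\varepsilon_i^*$ contraction. $\mathcal D_q=\sum_i\varepsilon_iD_{q,z_i}$, $\mathcal D_q^\dagger=\sum_i\iota_iD_{q,w_i}$, $\mathcal Z=\sum_i\iota_iz_i$, $\mathcal Z^\dagger=\sum_i\varepsilon_iw_i$ (coordinates acting by multiplication). *)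

(* Defs.v *)
From HB Require Import structures.
From mathcomp Require Import all_boot all_order all_algebra.
From mathcomp Require Export reals complex mpoly.

Set Implicit Arguments.
Unset Strict Implicit.
Unset Printing Implicit Defensive.

Import GRing.Theory Num.Theory.
Local Open Scope ring_scope.

Definition qnum (K : fieldType) (q : K) (r : nat) : K :=
  (1 - q ^+ r) / (1 - q).

Definition commutator (V : zmodType) (X Y : V -> V) : V -> V :=
  fun u => X (Y u) - Y (X u).

Definition anticommutator (V : zmodType) (X Y : V -> V) : V -> V :=
  fun u => X (Y u) + Y (X u).

(* Linear span of a possibly infinite family, hence not a [{vspace V}]. *)
Definition in_span (K : pzRingType) (V : lmodType K) (P : V -> Prop) (v : V)
    : Prop :=
  exists s : seq (K * V),
    (forall x, x \in s -> P x.2) /\ v = \sum_(x <- s) x.1 *: x.2.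

Section Jackson.
Variables (K : fieldType) (n : nat).
Implicit Types (p : {mpoly K[n]}) (q : K) (i : 'I_n).

Definition qdilate q i p : {mpoly K[n]} :=
  p \mPo [tuple (if j == i then q *: 'X_j else 'X_j) | j < n].

(* Quotient of the division of [p] by ['X_i]: the terms of [p] not divisible by
   ['X_i] are dropped.  [jacksonP] below shows that no term is dropped in the
   Jackson quotient. *)
Definition divX i p : {mpoly K[n]} :=
  \sum_(mu <- msupp p | (0 < mu i)%N) p@_mu *: 'X_[mu - U_(i)].

Definition jackson q i p : {mpoly K[n]} :=
  (q - 1)^-1 *: divX i (qdilate q i p - p).

Lemma qdilateX q i (mu : 'X_{1..n}) :
  qdilate q i 'X_[mu] = q ^+ mu i *: 'X_[mu].
Proof.
rewrite /qdilate comp_mpolyX (mpolyXE_id _ mu) (bigD1 i) //=.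
rewrite [X in _ *: X](bigD1 i) //= tnth_mktuple eqxx exprZn -scalerAl.
congr (_ *: (_ * _)); apply: eq_bigr => j /negPf nji.
by rewrite tnth_mktuple nji.
Qed.

Lemma mcoeff_qdilate q i p (mu : 'X_{1..n}) :
  (qdilate q i p)@_mu = q ^+ mu i * p@_mu.
Proof.
have -> : p@_mu = \sum_(nu <- msupp p) p@_nu * (nu == mu)%:R.
  rewrite {1}(mpolyE p) raddf_sum /=; apply: eq_bigr => nu _.
  by rewrite mcoeffZ mcoeffX.
rewrite /qdilate comp_mpolyE raddf_sum mulr_sumr /=; apply: eq_bigr => nu _.
rewrite -comp_mpolyX -/(qdilate q i 'X_[nu]) qdilateX !mcoeffZ mcoeffX.
by case: eqP => [->|_]; rewrite ?mulr0 // !mulr1 mulrC.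
Qed.

Lemma mulX_divX i p :
  (forall mu : 'X_{1..n}, mu i = 0%N -> p@_mu = 0) -> 'X_i * divX i p = p.
Proof.
move=> p0; rewrite /divX mulr_sumr [RHS](mpolyE p) big_mkcond /=.
apply: eq_bigr => mu _; case: posnP => [/p0->|mui]; first by rewrite scale0r.
by rewrite -scalerAr -mpolyXD addmC submK // lep1mP -lt0n.
Qed.

(* This determines [jackson q i p], as [{mpoly K[n]}] is an integral domain. *)
Lemma jacksonP q i p :
  q != 1 -> ((q - 1) *: 'X_i) * jackson q i p = qdilate q i p - p.
Proof.
move=> q1; rewrite /jackson -scalerAl -scalerAr scalerA divff ?subr_eq0 //.
rewrite scale1r mulX_divX // => mu mui.
by rewrite mcoeffB mcoeff_qdilate mui expr0 mul1r subrr.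
Qed.

End Jackson.

Section Exterior.
Variables (K : numClosedFieldType) (m : nat).

(* An operator on the exterior algebra of [K^m] is given by its matrix in the
   basis [e_S]: [M T S] is the coefficient of [e_T] in [M e_S]. *)
Definition extop := {set 'I_m} -> {set 'I_m} -> K.

(* Action of [id (x) M] on the tensor product of [V] with the exterior algebra,
   whose elements are written as families of coordinates along the [e_S]. *)
Definition extact (V : lmodType K) (M : extop) (u : {ffun {set 'I_m} -> V})
    : {ffun {set 'I_m} -> V} :=
  [ffun T => \sum_S M T S *: u S].

Definition extadj (M : extop) : extop := fun S T => (M T S)^*.

(* With [e_S] the wedge product of the [e_j], j in S, in increasing order,
   [e_i /\ e_S = (-1) ^ #{j in S | j < i} e_(S U {i})] if [i] is not in [S],
   and [e_i /\ e_S = 0] otherwise. *)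
Definition ext_eps (i : 'I_m) : extop := fun T S =>
  if (i \notin S) && (T == i |: S) then (-1) ^+ #|[set j in S | (j < i)%N]|
  else 0.

Definition ext_iota (i : 'I_m) : extop := extadj (ext_eps i).

(* The Hermitian product for which the [e_S] are orthonormal. *)
Definition extdot (u v : {ffun {set 'I_m} -> K^o}) : K :=
  \sum_S u S * (v S)^*.

Lemma extadjP (M : extop) (u v : {ffun {set 'I_m} -> K^o}) :
  extdot (extact M u) v = extdot u (extact (extadj M) v).
Proof.
rewrite /extdot; under eq_bigr => T _ do rewrite ffunE mulr_suml.
rewrite exchange_big /=; apply: eq_bigr => S _.
rewrite ffunE rmorph_sum mulr_sumr /=; apply: eq_bigr => T _.
by rewrite /extadj !rmorphM /= conjCK mulrCA mulrA.
Qed.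

End Exterior.

Section Spinor.
Variables (K : numClosedFieldType) (m : nat).

(* [u S] is the polynomial coefficient of [e_S]. *)
Definition spinor := {ffun {set 'I_m} -> {mpoly K[m + m]}}.

Definition zi (i : 'I_m) : 'I_(m + m) := lshift m i.
Definition wi (i : 'I_m) : 'I_(m + m) := rshift m i.

(* [z^alpha w^beta e_S] *)
Definition monospinor (alpha beta : 'X_{1..m}) (S : {set 'I_m}) : spinor :=
  [ffun T => if T == S
             then (\prod_i 'X_(zi i) ^+ alpha i) * (\prod_i 'X_(wi i) ^+ beta i)
             else 0].

(* Action of [f (x) id], for [f] an operator on polynomials. *)
Definition polyact (f : {mpoly K[m + m]} -> {mpoly K[m + m]}) (u : spinor)
    : spinor := [ffun S => f (u S)].

Definition opD (q : K) (u : spinor) : spinor :=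
  \sum_i extact (ext_eps K i) (polyact (jackson q (zi i)) u).

Definition opDdag (q : K) (u : spinor) : spinor :=
  \sum_i extact (ext_iota K i) (polyact (jackson q (wi i)) u).

Definition opZ (u : spinor) : spinor :=
  \sum_i extact (ext_iota K i) (polyact ( *%R 'X_(zi i)) u).

Definition opZdag (u : spinor) : spinor :=
  \sum_i extact (ext_eps K i) (polyact ( *%R 'X_(wi i)) u).

Definition opA (q : K) : spinor -> spinor := anticommutator (opD q) opZ.

Definition opB (q : K) : spinor -> spinor := anticommutator (opDdag q) opZdag.

End Spinor.

(* Main.v *)
Require Import Defs.
From HB Require Import structures.
From mathcomp Require Import all_boot all_order all_algebra.

(* In the basis of monomials tensor e_S, each of the four operators is a sum over
   i of terms toggling i in S, with the Koszul sign of i in S, and shifting the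
   exponent of z_i (or w_i) by one.  In the anticommutators the terms with i <> j
   cancel by the signs, and the diagonal ones give the eigenvalue.  The operators
   preserve this eigenvalue, as they trade an exponent for the membership of i
   in S: hence the commutators vanish.  The kernels consist of the basis vectors
   of eigenvalue 0, where each q-number [r]_q, being nonnegative and zero only
   for r = 0, vanishes separately. *)

Set Implicit Arguments.
Unset Strict Implicit.
Unset Printing Implicit Defensive.

Import Order.TTheory GRing.Theory Num.Theory.
Local Open Scope ring_scope.

(** * Sign and vanishing of q-numbers *)

Lemma qnum0 (K : fieldType) (q : K) : qnum q 0 = 0.
Proof. by rewrite /qnum expr0 subrr mul0r. Qed.

Lemma qnum_ge0 (K : numFieldType) (q : K) r : 0 < q -> q < 1 -> 0 <= qnum q r.
Proof.
move=> q0 q1; rewrite /qnum divr_ge0 // subr_ge0 ?(ltW q1) //.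
by rewrite exprn_ile1 // ltW.
Qed.

Lemma qnum_eq0 (K : numFieldType) (q : K) r :
  0 < q -> q < 1 -> (qnum q r == 0) = (r == 0%N).
Proof.
move=> q0 q1; rewrite /qnum mulf_eq0 invr_eq0 !subr_eq0.
rewrite [1 == q]gt_eqF // orbF eq_sym; case: r => [|r].
  by rewrite expr0 !eqxx.
by rewrite lt_eqF // exprn_ilt1 // ltW.
Qed.

(** * The Jackson derivative on coefficients and on monomials *)

Section Jackson.
Variables (K : fieldType) (n : nat).
Implicit Types (p : {mpoly K[n]}) (q : K) (i : 'I_n) (mu : 'X_{1..n}).

Lemma subm_eq (mu nu rho : 'X_{1..n}) :
  (rho <= mu)%MM -> ((mu - rho)%MM == nu) = (mu == (nu + rho)%MM).
Proof. by move=> le; apply/eqP/eqP => [<-|->]; rewrite ?submK ?addmK. Qed.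

Lemma mcoeff_divX i p mu : (divX i p)@_mu = p@_(mu + U_(i)).
Proof.
rewrite /divX raddf_sum /= [X in X@__](mpolyE p) raddf_sum /= big_mkcond /=.
apply: eq_bigr => nu _; rewrite !mcoeffZ !mcoeffX.
case: posnP => [nui|nui].
  case: eqP => [e|_]; last by rewrite mulr0.
  by move: nui; rewrite e mnmDE mnm1E eqxx addn1.
by rewrite subm_eq // lep1mP -lt0n.
Qed.

(** Dilation scales the coefficient at [mu + U_(i)] by [q ^+ (mu i).+1], so the difference quotient
    produces the q-number of the raised exponent. *)
Lemma mcoeff_jackson q i p mu : q != 1 ->
  (jackson q i p)@_mu = qnum q (mu i).+1 * p@_(mu + U_(i)).
Proof.
move=> q1; rewrite /jackson mcoeffZ mcoeff_divX mcoeffB mcoeff_qdilate.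
rewrite mnmDE mnm1E eqxx addn1 /qnum -(opprB q 1) invrN mulrN -mulNr opprB.
by rewrite -[X in _ * (_ - X)]mul1r -mulrBl mulrA [_^-1 * _]mulrC.
Qed.

(** The linear structure is declared for every [q], so coefficients are computed from the definition
    rather than from [mcoeff_jackson], which assumes [q != 1]. *)
Lemma jackson_is_linear q i : linear (jackson q i).
Proof.
move=> a p r; apply/mpolyP => mu.
rewrite mcoeffD mcoeffZ /jackson !mcoeffZ !mcoeff_divX !mcoeffB.
rewrite !mcoeff_qdilate !mcoeffD !mcoeffZ mulrCA -mulrDr; congr (_ * _).
by rewrite mulrBr mulrDr (mulrCA a) opprD addrACA.
Qed.

HB.instance Definition _ q i :=
  GRing.isLinear.Build K {mpoly K[n]} {mpoly K[n]} *:%R (jackson q i)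
    (jackson_is_linear q i).

Lemma jacksonX q i mu : q != 1 ->
  jackson q i 'X_[mu] = qnum q (mu i) *: 'X_[mu - U_(i)].
Proof.
move=> q1; apply/mpolyP => nu; rewrite mcoeff_jackson // mcoeffZ !mcoeffX.
have [mui|mui] := posnP (mu i).
  (* Here [mu - U_(i)] truncates to [mu]; both sides vanish, since no [nu + U_(i)] has exponent 0 at
     [i]. *)
  rewrite mui qnum0 mul0r; case: eqP => [e|_]; last by rewrite mulr0.
  by move: mui; rewrite e mnmDE mnm1E eqxx addn1.
rewrite subm_eq ?lep1mP -?lt0n //.
case: eqP => [->|_]; last by rewrite !mulr0.
by rewrite mnmDE mnm1E eqxx addn1.
Qed.

End Jackson.

(** * Toggling an index in a subset *)

Section Toggle.
Variable m : nat.
Implicit Types (i j : 'I_m) (S T : {set 'I_m}).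

(** Symmetric difference with the singleton of [i]: exterior multiplication and contraction both
    send [e_S] to a multiple of [e_(toggle i S)]. *)
Definition toggle i S := if i \in S then S :\ i else i |: S.

Lemma in_toggle i j S : (j \in toggle i S) = (j \in S) (+) (j == i).
Proof.
rewrite /toggle; case: ifP => iS; rewrite !inE;
  by case: eqP => [->|_]; rewrite ?iS ?addbF.
Qed.

Lemma toggleC i j S : toggle i (toggle j S) = toggle j (toggle i S).
Proof. by apply/setP => k; rewrite !in_toggle addbAC. Qed.

Lemma toggleK i : involutive (toggle i).
Proof. by move=> S; apply/setP => k; rewrite !in_toggle addbK. Qed.

End Toggle.

(** * Koszul signs and the matrices of multiplication and contraction *)

Section Exterior.
Variables (K : numClosedFieldType) (m : nat).
Implicit Types (i j : 'I_m) (S T : {set 'I_m}) (b : bool).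

Definition xsign i S : K := (-1) ^+ #|[set j in S | (j < i)%N]|.

Lemma xsign_toggle i j S :
  xsign i (toggle j S) = (-1) ^+ (j < i)%N * xsign i S.
Proof.
(* As a product over all indices, the sign changes under the toggle only in its factor at [j]. *)
have xE S' : xsign i S' = \prod_k (-1) ^+ ((k \in S') && (k < i)%N).
  rewrite /xsign -prodr_const big_mkcond /=; apply: eq_bigr => k _.
  by rewrite inE; case: (_ && _).
rewrite !xE (bigD1 j) //= [X in _ = _ * X](bigD1 j) //= mulrA.
congr (_ * _).
  by rewrite in_toggle eqxx; case: (j \in S); case: (j < i)%N;
    rewrite ?expr0 ?mulr1 ?mul1r // -expr2 sqrrN expr1n.
by apply: eq_bigr => k /negPf kj; rewrite in_toggle kj addbF.
Qed.

Lemma xsign_toggle_id i S : xsign i (toggle i S) = xsign i S.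
Proof. by rewrite xsign_toggle ltnn mul1r. Qed.

Lemma xsign_sqr i S : xsign i S * xsign i S = 1.
Proof. by rewrite /xsign -expr2 -exprM mulnC exprM sqrrN expr1n expr1n. Qed.

(** Exactly one of [i < j] and [j < i] holds, so exactly one of the two toggles flips the other
    sign. *)
Lemma xsign_anti i j S : i != j ->
  xsign i S * xsign j (toggle i S) = - (xsign j S * xsign i (toggle j S)).
Proof.
move=> ij; rewrite !xsign_toggle.
have : (i < j)%N (+) (j < i)%N by case: ltngtP ij => // /val_inj->; rewrite eqxx.
case: (i < j)%N; case: (j < i)%N => //= _; rewrite !expr1 !expr0;
  by rewrite ?(mulN1r, mul1r, mulrN, opprK) mulrC.
Qed.

(** The flag [b] is the membership of [i] in [S] required for [e_S] not to be killed. *)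
Definition ext_gen b i : extop K m := if b then ext_iota K i else ext_eps K i.

(** Contraction is the conjugate transpose of multiplication; the sign is real and counts only
    indices below [i], hence survives both conjugation and the toggle of [i]. *)
Lemma ext_genE b i T S :
  ext_gen b i T S =
    if ((i \in S) == b) && (T == toggle i S) then xsign i S else 0.
Proof.
case: b; rewrite /ext_gen /ext_iota /extadj /ext_eps; last first.
  by rewrite eqbF_neg; case: (boolP (i \in S)) => //= /negPf iS;
    rewrite /toggle iS.
have -> : (i \notin T) && (S == i |: T) = (i \in S) && (T == toggle i S).
  apply/andP/andP => [[/negPf iT /eqP ->]|[iS /eqP ->]].
    have -> : i |: T = toggle i T by rewrite /toggle iT.
    by rewrite in_toggle iT eqxx toggleK.
  by rewrite in_toggle iS eqxx; split=> //; rewrite /toggle iS setD1K.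
rewrite eqb_id; case: andP => [[_ /eqP ->]|_]; last exact: conjC0.
rewrite -/(xsign i _) xsign_toggle_id /xsign rmorphXn /=.
by rewrite rmorphN1.
Qed.

End Exterior.

(** * The monomial basis of spinors and the common form of the four operators *)

Section Spinor.
Variables (K : numClosedFieldType) (m : nat).
Implicit Types (i j : 'I_m) (S T : {set 'I_m}) (b : bool).
Implicit Types (p : {mpoly K[m + m]}) (mu : 'X_{1..m + m}).

Definition pure S p : spinor K m := [ffun T => if T == S then p else 0].

Lemma pure_is_linear S : linear (pure S).
Proof.
move=> a p r; apply/ffunP => T; rewrite !ffunE.
by case: eqP; rewrite // scaler0 addr0.
Qed.

HB.instance Definition _ S :=
  GRing.isLinear.Build K {mpoly K[m + m]} (spinor K m) *:%R (pure S)
    (pure_is_linear S).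

Lemma spinorE (u : spinor K m) :
  u = \sum_S \sum_(mu <- msupp (u S)) (u S)@_mu *: pure S 'X_[mu].
Proof.
have uE S : \sum_(mu <- msupp (u S)) (u S)@_mu *: pure S 'X_[mu] = pure S (u S).
  rewrite [in RHS](mpolyE (u S)) (raddf_sum (pure S)) /=.
  by apply: eq_bigr => mu _; rewrite linearZ_LR.
under eq_bigr do rewrite uE.
apply/ffunP => T; rewrite sum_ffunE (bigD1 T) //= ffunE eqxx.
by rewrite big1 ?addr0 // => S /negPf ST; rewrite ffunE eq_sym ST.
Qed.

(** Reduces the commutation relations to the monomial basis. *)
Lemma linear_spinor_eq (f g : {linear spinor K m -> spinor K m}) :
  (forall mu S, f (pure S 'X_[mu]) = g (pure S 'X_[mu])) -> f =1 g.
Proof.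
move=> fg u; rewrite (spinorE u) !linear_sum; apply: eq_bigr => S _ /=.
by rewrite !linear_sum; apply: eq_bigr => mu _; rewrite !linearZ /= fg.
Qed.

Section Contraction.
Variables (b : bool) (f : 'I_m -> {linear {mpoly K[m + m]} -> {mpoly K[m + m]}}).

Definition ext_contract (u : spinor K m) : spinor K m :=
  \sum_i extact (ext_gen K b i) (polyact (f i) u).

Lemma ext_contract_is_linear : linear ext_contract.
Proof.
move=> a u v; rewrite /ext_contract scaler_sumr -big_split /=.
apply: eq_bigr => i _; apply/ffunP => T; rewrite !ffunE scaler_sumr -big_split.
apply: eq_bigr => S _ /=; rewrite !ffunE linearP scalerDr !scalerA.
by rewrite [a * _]mulrC.
Qed.

HB.instance Definition _ :=
  GRing.isLinear.Build K (spinor K m) (spinor K m) *:%R ext_contract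
    ext_contract_is_linear.

Lemma ext_contract_pure p S :
  ext_contract (pure S p) =
    \sum_i (if (i \in S) == b then xsign K i S else 0) *:
      pure (toggle i S) (f i p).
Proof.
(* Only column [S] of the matrix meets the support of [pure S p]. *)
apply: eq_bigr => i _; apply/ffunP => T; rewrite !ffunE (bigD1 S) //= !ffunE.
rewrite eqxx big1 => [|S' /negPf S'S]; last first.
  by rewrite !ffunE S'S linear0 scaler0.
rewrite addr0 ext_genE; case: (_ == b); rewrite ?scale0r //=.
by case: eqP; rewrite ?scale0r ?scaler0.
Qed.

End Contraction.

End Spinor.

(** * Linearity of the anticommutator *)

Section Anticommutator.
Variables (K : pzRingType) (V : lmodType K) (F G : {linear V -> V}).

Lemma anticommutator_is_linear : linear (anticommutator F G).
Proof. by move=> a u v; rewrite /anticommutator !linearP addrACA scalerDr. Qed.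

HB.instance Definition _ :=
  GRing.isLinear.Build K V V *:%R (anticommutator F G) anticommutator_is_linear.

End Anticommutator.

(** * Diagonalization, commutators and kernel, for both pairs of operators at once *)

Section Weights.
Variables (K : numClosedFieldType) (m : nat) (q : K) (b : bool).
Variable x : 'I_m -> 'I_(m + m).
Hypotheses (x_inj : injective x) (q_neq1 : q != 1).
Implicit Types (i j : 'I_m) (S T : {set 'I_m}) (mu : 'X_{1..m + m}).

(* The lowering operator is [opD q] for [b = false], [x = zi m], and
   [opDdag q] for [b = true], [x = wi m]; the raising operator is then [opZ],
   respectively [opZdag]. *)
Definition lowering := ext_contract b (fun i => jackson q (x i)).
Definition raising :=
  ext_contract (~~ b) (fun i => ('X_(x i) : {mpoly K[m + m]}) \*o idfun).

HB.instance Definition _ := GRing.Linear.on lowering.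
HB.instance Definition _ := GRing.Linear.on raising.

(** The indicator added to the exponent is that of [i] in [S] for [b = false], and one minus it for
    [b = true]. *)
Definition weight mu S : K := \sum_i qnum q (mu (x i) + ((i \in S) != b)).

Lemma lowering_pure mu S :
  lowering (pure S 'X_[mu]) =
    \sum_i ((if (i \in S) == b then xsign K i S else 0) * qnum q (mu (x i))) *:
      pure (toggle i S) 'X_[mu - U_(x i)].
Proof.
rewrite /lowering ext_contract_pure; apply: eq_bigr => i _.
by rewrite /= jacksonX // linearZ /= scalerA.
Qed.

Lemma raising_pure mu S :
  raising (pure S 'X_[mu]) =
    \sum_i (if (i \in S) == ~~ b then xsign K i S else 0) *:
      pure (toggle i S) 'X_[mu + U_(x i)].
Proof.
rewrite /raising ext_contract_pure; apply: eq_bigr => i _.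
by rewrite mpolyXD /= mulrC.
Qed.

(* For [mu (x i) = 0] the truncated subtractions differ, but [qnum q 0 = 0]. *)
Lemma qnum_lowering_raising c mu i j S : i != j ->
  (c * qnum q (mu (x i))) *: pure S 'X_[mu + U_(x j) - U_(x i)]
  = (c * qnum q (mu (x i))) *: pure S 'X_[mu - U_(x i) + U_(x j)].
Proof.
move=> ij; have [->|mui] := posnP (mu (x i)); first by rewrite qnum0 mulr0 !scale0r.
congr (_ *: pure _ 'X_[_]); apply/mnmP => k.
rewrite !(mnmBE, mnmDE) !mnm1E; have [<-|] := eqVneq (x i) k.
  by rewrite (inj_eq x_inj) [j == i]eq_sym (negPf ij) !addn0.
by rewrite !subn0.
Qed.

Lemma anticommutator_pure mu S :
  anticommutator lowering raising (pure S 'X_[mu]) =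
    weight mu S *: pure S 'X_[mu].
Proof.
rewrite /anticommutator lowering_pure raising_pure !linear_sum /=.
under eq_bigr => j _ do rewrite linearZ /= lowering_pure scaler_sumr.
under [X in _ + X]eq_bigr => i _ do rewrite linearZ /= raising_pure scaler_sumr.
(* Both products are indexed alike, [i] being lowered and [j] raised, so that they combine term by
   term. *)
rewrite exchange_big -big_split /weight scaler_suml; apply: eq_bigr => i _ /=.
rewrite -big_split (bigD1 i) //= big1 ?addr0 => [|j ji]; last first.
  have ij : i != j by rewrite eq_sym.
  rewrite !scalerA ![_ * (_ * qnum _ _)]mulrA [_ * qnum _ _ * _]mulrAC.
  rewrite mnmDE mnm1E (inj_eq x_inj) (negPf ji) addn0.
  rewrite !in_toggle (negPf ji) (negPf ij) !addbF toggleC.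
  rewrite qnum_lowering_raising // -scalerDl -mulrDl.
  (* Off the diagonal both orders reach the same basis vector with the same q-number, and the signs
     are opposite. *)
  case: (_ == b); case: (_ == ~~ b); rewrite ?(mul0r, mulr0, addr0, scale0r) //.
  by rewrite xsign_anti // addNr mul0r scale0r.
rewrite !scalerA !toggleK !in_toggle eqxx addbT !addmK xsign_toggle_id.
rewrite mnmDE mnm1E eqxx.
have -> : (~~ (i \in S) == b) = ((i \in S) == ~~ b) by case: (i \in S); case: b.
have -> : (~~ (i \in S) == ~~ b) = ((i \in S) == b) by case: (i \in S); case: b.
(* On the diagonal one order survives: lowering first gives the q-number of [mu (x i)], raising
   first that of its successor. *)
have [iS|iS] := eqVneq (i \in S) b.
  rewrite iS; have -> : (b == ~~ b) = false by case: b.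
  rewrite !mul0r scale0r add0r addn0 mulrAC xsign_sqr mul1r.
  have [->|mui] := posnP (mu (x i)); first by rewrite qnum0 !scale0r.
  by rewrite submK // lep1mP -lt0n.
have -> : (i \in S) == ~~ b by case: (i \in S) iS; case: b.
by rewrite !mul0r scale0r addr0 mulrA xsign_sqr mul1r.
Qed.

(** The toggle turns the indicator at [i] from 0 to 1, compensating the lost exponent; positivity of
    [mu (x i)] keeps the subtraction exact. *)
Lemma weight_lowering mu S i : (i \in S) == b -> (0 < mu (x i))%N ->
  weight (mu - U_(x i)) (toggle i S) = weight mu S.
Proof.
move=> iS mui; apply: eq_bigr => j _; rewrite in_toggle mnmBE mnm1E (inj_eq x_inj).
have [->|ji] := eqVneq j i; last by rewrite subn0 addbF.
rewrite ?eqxx addbT (eqP iS) eqxx addn0.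
have -> : ~~ b != b by case: b.
by rewrite subnK.
Qed.

Lemma weight_raising mu S i : (i \in S) == ~~ b ->
  weight (mu + U_(x i)) (toggle i S) = weight mu S.
Proof.
move=> iS; apply: eq_bigr => j _; rewrite in_toggle mnmDE mnm1E (inj_eq x_inj).
have [->|ji] := eqVneq j i; last by rewrite addn0 addbF.
rewrite ?eqxx addbT (eqP iS) negbK eqxx addn0.
by have -> : ~~ b != b by case: b.
Qed.

Lemma anticommutator_lowering :
  anticommutator lowering raising \o lowering
  =1 lowering \o anticommutator lowering raising.
Proof.
apply: linear_spinor_eq => mu S /=; rewrite anticommutator_pure linearZ /=.
rewrite lowering_pure linear_sum scaler_sumr; apply: eq_bigr => i _ /=.
rewrite linearZ /= anticommutator_pure !scalerA.
case: eqP => [/eqP iS|_]; last by rewrite !(mul0r, mulr0) !scale0r.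
(* A zero exponent, where the weight could change, comes with a zero coefficient. *)
have [->|mui] := posnP (mu (x i)).
  by rewrite qnum0 !(mul0r, mulr0) !scale0r.
by rewrite weight_lowering // mulrC.
Qed.

Lemma anticommutator_raising :
  anticommutator lowering raising \o raising
  =1 raising \o anticommutator lowering raising.
Proof.
apply: linear_spinor_eq => mu S /=; rewrite anticommutator_pure linearZ /=.
rewrite raising_pure linear_sum scaler_sumr; apply: eq_bigr => i _ /=.
rewrite linearZ /= anticommutator_pure !scalerA.
case: eqP => [/eqP iS|_]; last by rewrite !(mul0r, mulr0) !scale0r.
by rewrite weight_raising // mulrC.
Qed.

(** Diagonal action read coefficientwise, so that a spinor in the kernel can have nonzero
    coefficients only at weight 0. *)
Lemma mcoeff_anticommutator (u : spinor K m) S mu :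
  (anticommutator lowering raising u S)@_mu = weight mu S * (u S)@_mu.
Proof.
rewrite [in LHS](spinorE u) linear_sum sum_ffunE raddf_sum /=.
rewrite (bigD1 S) //= [X in _ + X]big1 ?addr0 => [|T /negPf TS]; last first.
  rewrite linear_sum sum_ffunE raddf_sum big1 //= => nu _.
  by rewrite linearZ /= anticommutator_pure !ffunE eq_sym TS !scaler0 mcoeff0.
rewrite linear_sum sum_ffunE raddf_sum /= [in RHS](mpolyE (u S)) raddf_sum /=.
rewrite mulr_sumr; apply: eq_bigr => nu _; rewrite linearZ /= anticommutator_pure.
rewrite !ffunE eqxx !mcoeffZ !mcoeffX.
by case: eqP => [->|_]; rewrite ?mulr0 // mulrCA.
Qed.

Hypotheses (q_gt0 : 0 < q) (q_lt1 : q < 1).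

Lemma weight_eq0 mu S :
  weight mu S = 0 ->
  (forall i, mu (x i) = 0%N) /\ S = if b then [set: 'I_m] else set0.
Proof.
move/eqP; rewrite psumr_eq0 => [/allP w0|i _]; last exact: qnum_ge0.
have {}w0 i : (mu (x i) == 0%N) && ((i \in S) == b).
  have := w0 i (mem_index_enum i).
  by rewrite /= qnum_eq0 // addn_eq0 eqb0 negbK.
split=> [i|]; first by case/andP: (w0 i) => /eqP.
apply/setP => i; case/andP: (w0 i) => _ /eqP ->.
by case: b; rewrite inE.
Qed.

Lemma weight_bottom mu :
  (forall i, mu (x i) = 0%N) -> weight mu (if b then [set: 'I_m] else set0) = 0.
Proof.
move=> mu0; apply: big1 => i _; rewrite mu0.
by case: b; rewrite inE qnum0.
Qed.

(** The spanning family is an abstract [P], to be matched with the families of [monospinor] in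
    either kernel statement. *)
Lemma ker_anticommutator (P : spinor K m -> Prop) (u : spinor K m) :
  (forall v, P v <-> exists2 mu : 'X_{1..m + m}, forall i, mu (x i) = 0%N &
     v = pure (if b then [set: 'I_m] else set0) 'X_[mu]) ->
  anticommutator lowering raising u = 0 <-> in_span P u.
Proof.
move=> PE; split=> [Au0|[s [sP ->]]].
  pose S0 := if b then [set: 'I_m] else set0 : {set 'I_m}.
  have u0 S mu : mu \in msupp (u S) -> weight mu S = 0.
    rewrite mcoeff_msupp => /negPf umu; apply/eqP.
    by rewrite -[_ == 0]orbF -umu -mulf_eq0 -mcoeff_anticommutator Au0 ffunE mcoeff0.
  (* The combination is the monomial expansion of the single component [u S0]. *)
  exists [seq ((u S0)@_mu, pure S0 'X_[mu]) | mu <- msupp (u S0)]; split.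
    move=> _ /mapP[mu /u0 /weight_eq0[mu0 _] ->]; apply/PE.
    by exists mu.
  rewrite big_map [LHS]spinorE (bigD1 S0) //= [X in _ + X]big1 ?addr0 // => S SS0.
  (* A monomial in another component would have weight 0, which forces its subset to be [S0]. *)
  rewrite big_seq big1 // => mu /u0 /weight_eq0[_ SE].
  by rewrite SE eqxx in SS0.
rewrite linear_sum big_seq big1 // => -[c v] /sP /= /PE[mu mu0 ->].
by rewrite linearZ /= anticommutator_pure weight_bottom // scale0r scaler0.
Qed.

End Weights.

(** * Pairs of multi-indices as exponents in the joint variables *)

Section Multidegree.
Variables (K : numClosedFieldType) (m : nat).
Implicit Types (alpha beta : 'X_{1..m}) (mu : 'X_{1..m + m}) (i : 'I_m).

Definition multidegree alpha beta : 'X_{1..m + m} :=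
  [multinom match split k with inl i => alpha i | inr i => beta i end | k < m + m].

Lemma multidegree_zi alpha beta i : multidegree alpha beta (zi i) = alpha i.
Proof. by rewrite mnmE /zi -[lshift m i]/(unsplit (inl i)) unsplitK. Qed.

Lemma multidegree_wi alpha beta i : multidegree alpha beta (wi i) = beta i.
Proof. by rewrite mnmE /wi -[rshift m i]/(unsplit (inr i)) unsplitK. Qed.

Lemma multidegreeE mu :
  mu = multidegree [multinom mu (zi i) | i < m] [multinom mu (wi i) | i < m].
Proof.
apply/mnmP => k; rewrite -(splitK k) /unsplit.
by case: (split k) => i; rewrite ?multidegree_zi ?multidegree_wi mnmE.
Qed.

Lemma monospinorE alpha beta S :
  monospinor K alpha beta S = pure S 'X_[multidegree alpha beta].
Proof.
apply/ffunP => T; rewrite !ffunE; case: eqP => // _.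
rewrite [RHS]mpolyXE_id big_split_ord /=; congr (_ * _); apply: eq_bigr => i _.
  by rewrite -/(zi i) multidegree_zi.
by rewrite -/(wi i) multidegree_wi.
Qed.

End Multidegree.

(** * Specialization to the two pairs of operators *)

Section Proposition.
Variables (K : numClosedFieldType) (m : nat) (q : K).
Hypotheses (q_gt0 : 0 < q) (q_lt1 : q < 1).
Implicit Types (alpha beta : 'X_{1..m}) (S : {set 'I_m}) (u : spinor K m).

Let q_neq1 : q != 1. Proof. by rewrite lt_eqF. Qed.
Let zi_inj : injective (@zi m) := @lshift_inj m m.
Let wi_inj : injective (@wi m) := @rshift_inj m m.

Lemma opA_monospinor alpha beta S :
  opA q (monospinor K alpha beta S) =
    (\sum_i qnum q (alpha i + (i \in S))) *: monospinor K alpha beta S.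
Proof.
rewrite monospinorE.
rewrite [LHS](anticommutator_pure false zi_inj q_neq1); congr (_ *: _).
by apply: eq_bigr => i _; rewrite multidegree_zi; case: (i \in S).
Qed.

Lemma opB_monospinor alpha beta S :
  opB q (monospinor K alpha beta S) =
    (\sum_i qnum q (beta i + 1 - (i \in S))) *: monospinor K alpha beta S.
Proof.
rewrite monospinorE.
rewrite [LHS](anticommutator_pure true wi_inj q_neq1); congr (_ *: _).
apply: eq_bigr => i _; rewrite multidegree_wi.
(* The natural-number subtraction is exact, as [beta i + 1] is at least the indicator. *)
by case: (i \in S); rewrite ?addnK ?addn0 ?subn0.
Qed.

Lemma commutator_opA_opD u : commutator (opA q) (opD q) u = 0.
Proof.
apply/eqP; rewrite subr_eq0; apply/eqP.
exact: (anticommutator_lowering false zi_inj q_neq1 u).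
Qed.

Lemma commutator_opA_opZ u : commutator (opA q) (@opZ K m) u = 0.
Proof.
apply/eqP; rewrite subr_eq0; apply/eqP.
exact: (anticommutator_raising false zi_inj q_neq1 u).
Qed.

Lemma commutator_opB_opDdag u : commutator (opB q) (opDdag q) u = 0.
Proof.
apply/eqP; rewrite subr_eq0; apply/eqP.
exact: (anticommutator_lowering true wi_inj q_neq1 u).
Qed.

Lemma commutator_opB_opZdag u : commutator (opB q) (@opZdag K m) u = 0.
Proof.
apply/eqP; rewrite subr_eq0; apply/eqP.
exact: (anticommutator_raising true wi_inj q_neq1 u).
Qed.

Lemma ker_opA u :
  opA q u = 0 <->
  in_span (fun v => exists alpha beta S,
             [/\ alpha = 0%MM, S = set0 & v = monospinor K alpha beta S]) u.
Proof.
apply: (ker_anticommutator (b := false) zi_inj q_neq1 q_gt0 q_lt1) => v.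
split=> [[alpha [beta [S [-> -> ->]]]]|[mu mu0 ->]].
  exists (multidegree 0%MM beta); last exact: monospinorE.
  by move=> i; rewrite multidegree_zi mnm0E.
(* The [w] exponents are read off [mu], whose [z] exponents all vanish. *)
exists 0%MM, [multinom mu (wi i) | i < m], set0; split=> //.
rewrite monospinorE [in LHS](multidegreeE mu); congr (pure _ 'X_[multidegree _ _]).
by apply/mnmP => i; rewrite mnmE mu0 mnm0E.
Qed.

Lemma ker_opB u :
  opB q u = 0 <->
  in_span (fun v => exists alpha beta S,
             [/\ beta = 0%MM, S = [set: 'I_m] & v = monospinor K alpha beta S]) u.
Proof.
apply: (ker_anticommutator (b := true) wi_inj q_neq1 q_gt0 q_lt1) => v.
split=> [[alpha [beta [S [-> -> ->]]]]|[mu mu0 ->]].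
  exists (multidegree alpha 0%MM); last exact: monospinorE.
  by move=> i; rewrite multidegree_wi mnm0E.
exists [multinom mu (zi i) | i < m], 0%MM, [set: 'I_m]; split=> //.
rewrite monospinorE [in LHS](multidegreeE mu); congr (pure _ 'X_[multidegree _ _]).
by apply/mnmP => i; rewrite mnmE mu0 mnm0E.
Qed.

End Proposition.

(** * The complex case with real [q] *)

Local Open Scope complex_scope.

Theorem proposition3p1 (R : realType) (m : nat) (q : R)
    (hm : (1 <= m)%N) (hq0 : 0 < q) (hq1 : q < 1) :
  let A : spinor R[i] m -> spinor R[i] m := opA q%:C in
  let B : spinor R[i] m -> spinor R[i] m := opB q%:C in
  (forall (alpha beta : 'X_{1..m}) (S : {set 'I_m}),
      A (monospinor R[i] alpha beta S) =
        (\sum_(i < m) qnum q%:C (alpha i + (i \in S))) *: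
          monospinor R[i] alpha beta S
      /\
      B (monospinor R[i] alpha beta S) =
        (\sum_(i < m) qnum q%:C (beta i + 1 - (i \in S))) *:
          monospinor R[i] alpha beta S)
  /\ (forall u : spinor R[i] m, commutator A (opD q%:C) u = 0)
  /\ (forall u : spinor R[i] m, commutator A (@opZ R[i] m) u = 0)
  /\ (forall u : spinor R[i] m, commutator B (opDdag q%:C) u = 0)
  /\ (forall u : spinor R[i] m, commutator B (@opZdag R[i] m) u = 0)
  /\ (forall u : spinor R[i] m,
        A u = 0 <->
        in_span (fun v => exists (alpha beta : 'X_{1..m}) (S : {set 'I_m}),
                   [/\ alpha = 0%MM, S = set0 &
                       v = monospinor R[i] alpha beta S]) u)
  /\ (forall u : spinor R[i] m,
        B u = 0 <->
        in_span (fun v => exists (alpha beta : 'X_{1..m}) (S : {set 'I_m}),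
                   [/\ beta = 0%MM, S = [set: 'I_m] &
                       v = monospinor R[i] alpha beta S]) u).
Proof.
have qc0 : 0 < q%:C by rewrite ltcR.
have qc1 : q%:C < 1 by rewrite ltcR.
split=> [alpha beta S|].
  by split; [apply: opA_monospinor | apply: opB_monospinor].
split=> [u|]; first exact: commutator_opA_opD.
split=> [u|]; first exact: commutator_opA_opZ.
split=> [u|]; first exact: commutator_opB_opDdag.
split=> [u|]; first exact: commutator_opB_opZdag.
by split=> u; [apply: ker_opA | apply: ker_opB].
Qed.
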